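(* Consider a power system with $n$ generators, with parameters $M, D, f, E$ and reactances as described in the context, and let $\Gamma$ be the associated Kron-reduced matrix. The following two statements hold. (1) Let $n = 2$ and $M_1 = M_2$. Then the two generators are synchronized if and only if $D_1 = D_2$, $f_1 = f_2$, and $E_1 = E_2$. (2) Let $n \ge 3$, let $i \ne j$ be in $\{1,\dots,n\}$, and let $M \in \mathcal{S}_{ij}$. Then the $i$th and $j$th generators are synchronized if and only if $D \in \mathcal{S}_{ij}$, $f \in \mathcal{X}_{ij}$, $E \in \mathcal{X}_{ij}$, and $\Gamma \in \mathcal{S}_{ij}$.
   Context: Power system. Let $n \ge 1$, $\bar n \ge 0$, $\mathcal{G} = \{1,\dots,n\}$ (generators and their generator buses), $\overline{\mathcal{G}} = \{n+1,\dots,n+\bar n\}$ (non-generator buses). Given are constants $M_i > 0$, $D_i \ge 0$, $f_i \in \mathbb{R}$, $E_i > 0$, $\chi_i > 0$ for $i \in \mathcal{G}$, and a connected undirected graph on the buses $\mathcal{G} \cup \overline{\mathcal{G}}$ with a reactance $\chi_{ij} = \chi_{ji} > 0$ on each edge. Put $M = \mathrm{diag}(M_i)$, $D = \mathrm{diag}(D_i)$, $f = (f_i)$, $E = (E_i)$, $L_{\mathrm{D}} = \mathrm{diag}(\chi_1^{-1},\dots,\chi_n^{-1})$. Let $L \in \mathbb{R}^{(n+\bar n)\times(n+\bar n)}$ be the weighted graph Laplacian: for $i\neq j$, its $(i,j)$ entry is $-\chi_{ij}^{-1}$ if buses $i,j$ are adjacent and $0$ otherwise, and its diagonal entries make all row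 sums $0$. Partition $L = \begin{bmatrix} L_{11} & L_{12} \\ L_{12}^{\mathsf T} & L_{22}\end{bmatrix}$ according to $\mathcal{G}, \overline{\mathcal{G}}$ (if $\bar n = 0$, read $L_{11} - L_{12}L_{22}^{-1}L_{12}^{\mathsf T}$ as $L_{11}$). The unknowns are the generator phases $\delta(t) \in \mathbb{R}^n$ and the complex bus voltages $\mathbf{V}_{\mathcal{G}}(t) = [V_i(t)(\cos\theta_i(t) + \imath \sin\theta_i(t))]_{i \in \mathcal{G}} \in \mathbb{C}^n$ and $\mathbf{V}_{\overline{\mathcal{G}}}(t) \in \mathbb{C}^{\bar n}$, where $V_i(t)$, $\theta_i(t)$ are voltage amplitude and phase. With $\mathbf{E}_{\mathcal{G}}(t) = [E_i(\cos\delta_i(t) + \imath\sin\delta_i(t))]_{i\in\mathcal{G}}$, the power system is the differential-algebraic system, $t \ge 0$, $$M\ddot\delta(t) + D\dot\delta(t) = f - \Big[\tfrac{E_iV_i(t)}{\chi_i}\sin(\delta_i(t)-\theta_i(t))\Big]_{i\in\mathcal{G}}, \qquad \begin{bmatrix} L_{\mathrm{D}}(\mathbf{E}_{\mathcal{G}}(t) - \mathbf{V}_{\mathcal{G}}(t)) \\ 0\end{bmatrix} = \begin{bmatrix} L_{11} & L_{12} \\ L_{12}^{\mathsf T} & L_{22}\end{bmatrix}\begin{bmatrix}\mathbf{V}_{\mathcal{G}}(t)\\ \mathbf{V}_{\overline{\mathcal{G}}}(t)\end{bmatrix}.$$ Set $\Gamma = L_{\mathrm{D}}(L_{\mathrm{D}}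 + L_{11} - L_{12}L_{22}^{-1}L_{12}^{\mathsf T})^{-1}L_{\mathrm{D}}$, which is positive definite with positive entries. The system is equivalent to the Kron-reduced form $M_i\ddot\delta_i + D_i\dot\delta_i = f_i - \sum_{k=1}^n \Gamma_{ik}E_iE_k\sin(\delta_i-\delta_k)$, $i\in\mathcal{G}$, together with $L_{\mathrm{D}}\mathbf{V}_{\mathcal{G}}(t) = \Gamma\mathbf{E}_{\mathcal{G}}(t)$ and $\mathbf{V}_{\overline{\mathcal{G}}}(t) = -L_{22}^{-1}L_{12}^{\mathsf T}\mathbf{V}_{\mathcal{G}}(t)$. Notation. $\mathcal{X}_{ij} = \{x \in \mathbb{R}^n : x_i = x_j\}$; for a complex vector $x \in \mathbb{C}^n$, ''$x\in\mathcal{X}_{ij}$'' likewise means $x_i = x_j$. $\Pi_{ij}$ is the $n\times n$ permutation matrix of the transposition of $i$ and $j$, and $\mathcal{S}_{ij} = \{A \in \mathbb{R}^{n\times n} : A\Pi_{ij} = \Pi_{ij}A\}$. Definition. The $i$th and $j$th generators are synchronized if, for every initial condition $\delta(0),\dot\delta(0)\in\mathcal{X}_{ij}$, the solution satisfies $\delta(t)\in\mathcal{X}_{ij}$ and $\mathbf{V}_{\mathcal{G}}(t)\in\mathcal{X}_{ij}$ for all $t\ge0$. *)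

(* Defs.v *)
From HB Require Import structures.
From mathcomp Require Import all_boot all_order all_algebra all_fingroup.
From mathcomp Require Import complex.
From mathcomp Require Import all_classical all_reals all_analysis.
Set Implicit Arguments.
Unset Strict Implicit.
Unset Printing Implicit Defensive.
Import Order.TTheory GRing.Theory Num.Theory.
Import numFieldNormedType.Exports.
Local Open Scope classical_set_scope.
Local Open Scope ring_scope.
Local Open Scope complex_scope.

(* The buses are 'I_(n + nb): generator bus i is [lshift nb i], and the
   non-generator buses are the [rshift n k].  [line_reactance i j] is
   meaningful only on edges. *)
Record power_system (R : realType) (n nb : nat) := PowerSystem {
  inertia : 'cV[R]_n;
  damping : 'cV[R]_n;
  injection : 'cV[R]_n;
  emf : 'cV[R]_n;
  gen_reactance : 'cV[R]_n;
  adjacent : rel 'I_(n + nb);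
  line_reactance : 'I_(n + nb) -> 'I_(n + nb) -> R;
  inertia_gt0 : forall i, 0 < inertia i 0;
  damping_ge0 : forall i, 0 <= damping i 0;
  emf_gt0 : forall i, 0 < emf i 0;
  gen_reactance_gt0 : forall i, 0 < gen_reactance i 0;
  adjacent_sym : symmetric adjacent;
  adjacent_irr : irreflexive adjacent;
  adjacent_connected : forall i j, connect adjacent i j;
  line_reactance_gt0 : forall i j, adjacent i j -> 0 < line_reactance i j;
  line_reactance_sym :
    forall i j, adjacent i j -> line_reactance i j = line_reactance j i
}.

Definition cdiag_mx (R : realType) (n : nat) (v : 'cV[R]_n) : 'M[R]_n :=
  diag_mx v^T.

Definition Xset (T : Type) (n : nat) (i j : 'I_n) : set 'cV[T]_n :=
  [set x | x i 0 = x j 0].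

Definition Sset (R : realType) (n : nat) (i j : 'I_n) : set 'M[R]_n :=
  [set A | A *m tperm_mx i j = tperm_mx i j *m A].

Section PowerSystem.
Context {R : realType} {n nb : nat}.
Variable S : power_system R n nb.

Definition inertia_mx : 'M[R]_n := cdiag_mx (inertia S).
Definition damping_mx : 'M[R]_n := cdiag_mx (damping S).
Definition LD : 'M[R]_n := cdiag_mx (\col_i (gen_reactance S i 0)^-1).

Definition susceptance (i j : 'I_(n + nb)) : R :=
  if adjacent S i j then (line_reactance S i j)^-1 else 0.

Definition laplacian : 'M[R]_(n + nb) :=
  \matrix_(i, j) (if i == j then \sum_(k | k != i) susceptance i k
                  else - susceptance i j).

Definition L11 : 'M[R]_n := ulsubmx laplacian.
Definition L12 : 'M[R]_(n, nb) := ursubmx laplacian.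
Definition L22 : 'M[R]_nb := drsubmx laplacian.

(* L22 and the matrix inverted below are invertible because the graph is
   connected and 0 < n; for nb = 0 the term L12 *m invmx L22 *m L12^T is 0. *)
Definition Gamma : 'M[R]_n :=
  LD *m invmx (LD + L11 - L12 *m invmx L22 *m L12^T) *m LD.

End PowerSystem.

Definition complex_mx (R : realType) (m p : nat) (A : 'M[R]_(m, p))
  : 'M[R[i]]_(m, p) := map_mx (fun x => x%:C) A.

Definition phasor (R : realType) (n : nat) (r phi : 'cV[R]_n) : 'cV[R[i]]_n :=
  \col_k ((r k 0 * cos (phi k 0)) +i* (r k 0 * sin (phi k 0))).

(* [d] is the derivative at [t] of [x] restricted to [0, +oo[: two-sided for
   0 < t, and the right derivative at t = 0. *)
Definition is_derive_ge0 (R : realType) (n : nat) (x : R -> 'cV[R]_n)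
    (t : R) (d : 'cV[R]_n) : Prop :=
  forall k : 'I_n,
    (x s k 0 - x t k 0) / (s - t) @[s --> within [set s | 0 <= s] t^']
      --> d k 0.

(* Only the values at times t >= 0 matter.  [omega] is the velocity of
   [delta]; [V], [theta] are the amplitudes and phases of the generator bus
   voltages, and [Vb] the complex voltages of the non-generator buses. *)
Definition is_solution (R : realType) (n nb : nat) (S : power_system R n nb)
    (delta omega V theta : R -> 'cV[R]_n) (Vb : R -> 'cV[R[i]]_nb) : Prop :=
  forall t : R, 0 <= t ->
  [/\ is_derive_ge0 delta t (omega t),
      exists2 alpha : 'cV[R]_n, is_derive_ge0 omega t alpha &
        inertia_mx S *m alpha + damping_mx S *m omega t =
        injection S -
        \col_k (emf S k 0 * V t k 0 / gen_reactance S k 0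
                * sin (delta t k 0 - theta t k 0)),
      forall k, 0 <= V t k 0 &
      col_mx (complex_mx (LD S)
                *m (phasor (emf S) (delta t) - phasor (V t) (theta t))) 0 =
      block_mx (complex_mx (L11 S)) (complex_mx (L12 S))
               (complex_mx (L12 S)^T) (complex_mx (L22 S))
        *m col_mx (phasor (V t) (theta t)) (Vb t)].

(* The solution for a given initial condition is unique as far as [delta],
   [omega], the phasors and [Vb] are concerned ([theta] is not unique), so
   "the solution satisfies" is rendered by quantifying over all of them. *)
Definition synchronized (R : realType) (n nb : nat) (S : power_system R n nb)
    (i j : 'I_n) : Prop :=
  forall delta0 omega0 : 'cV[R]_n, Xset i j delta0 -> Xset i j omega0 ->
  forall (delta omega V theta : R -> 'cV[R]_n) (Vb : R -> 'cV[R[i]]_nb),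
    is_solution S delta omega V theta Vb ->
    delta 0 = delta0 -> omega 0 = omega0 ->
    forall t : R, 0 <= t ->
      Xset i j (delta t) /\ Xset i j (phasor (V t) (theta t)).

(* Main.v *)
(* Kron reduction eliminates the algebraic equations: the bus voltages are
   V = W E with W := (LD + L11 - L12 L22^-1 L12^T)^-1 LD, hence Gamma = LD W.
   The minimum principle for the graph Laplacian shows that W is positive, has
   row sums 1, and that the largest entry of each column is the diagonal one.

   If the pair (i, j) satisfies the conditions, then y := delta_i - delta_j
   solves a second-order equation with |y''| <= K (|y| + |y'|), so y = 0 by
   Gronwall.

   Conversely, a global solution exists for all initial data (Picard), so
   synchronization can be read off at t = 0, as an identity between the
   accelerations and between the voltages of i and j for all initial data in
   X_ij.  Data with all phases equal give f_i = f_j, then D_i = D_j; shifting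
   one other phase by pi / 2 gives W_ik = W_jk and Gamma_ik E_i = Gamma_jk E_j
   for k other than i, j.  As the rows of W have the same sum, the voltage
   identity becomes (W_ii - W_ji) (E_i - E_j) = 0, whence E_i = E_j. *)
Require Import Defs.
From mathcomp Require Import all_boot all_order all_algebra all_fingroup.
From mathcomp Require Import complex.
From mathcomp Require Import all_classical all_reals all_analysis.
From mathcomp Require Import ring lra.
Set Implicit Arguments.
Unset Strict Implicit.
Unset Printing Implicit Defensive.
Import Order.TTheory GRing.Theory Num.Theory.
Import numFieldNormedType.Exports.
Local Open Scope ring_scope.
Local Open Scope complex_scope.
Local Open Scope classical_set_scope.

(** * Global solutions of Lipschitz differential equations *)

(** Integrating from -1 makes every t >= 0 an interior point, so the derivative at 0 is two-sided as
    well; subtracting the value at 0 normalizes. *)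
Lemma continuous_antiderivative (R : realType) (f : R -> R) : continuous f ->
  exists2 F : R -> R, F 0 = 0 & forall t : R, 0 <= t -> is_derive t 1 F (f t).
Proof.
move=> cf.
pose G (x : R) := (\int[lebesgue_measure]_(t in `[(-1)%R, x]) f t)%R.
have dG (t : R) : 0 <= t -> is_derive t 1 G (f t).
  move=> t0; have a_t : (-1 : R) < t by apply: lt_le_trans t0; rewrite ltrN10.
  have t_u : t < t + 1 by rewrite ltrDl.
  have [|dG GE] := @continuous_FTC1_closed R f (-1) t (t + 1) t_u _ a_t (cf t).
    apply: continuous_compact_integrable; first exact: segment_compact.
    exact: continuous_subspaceT.
  by apply: DeriveDef; [exact: dG | rewrite -derive1E].
exists (fun t => G t - G 0); first by rewrite subrr.
move=> t /dG dGt.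
by apply: is_derive_eq; rewrite subr0.
Qed.

Lemma is_derive_expRM (R : realType) (l t : R) :
  is_derive t 1 (fun s => expR (l * s)) (l * expR (l * t)).
Proof.
have h1 : is_derive t 1 (fun s : R => l * s) l.
  have := @is_deriveZ R R R^o id l t 1 1 (is_derive_id _ _).
  by rewrite /GRing.scale /= mulr1.
have := @is_derive1_comp R expR (fun s => l * s) t _ _ _ h1.
by move=> /(_ (expR (l * t)) (is_derive_expR _)); rewrite mulrC.
Qed.

Lemma ger0_is_derive_le (R : realType) (h h' : R -> R) (T : R) : 0 <= T ->
  {within `[0, T], continuous h} ->
  (forall t : R, 0 < t < T -> is_derive t 1 h (h' t)) ->
  (forall t, 0 < t < T -> 0 <= h' t) -> h 0 <= h T.
Proof.
rewrite le_eqVlt => /predU1P[T0|T0] ch dh h'0; first by rewrite T0.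
have dh' (t : R) : t \in `]0, T[%R -> is_derive t 1 h (h' t).
  by rewrite in_itv /=; exact: dh.
have [c] := MVT T0 dh' ch.
rewrite in_itv /= => c0T hE; rewrite -subr_ge0 hE.
by rewrite mulr_ge0 ?h'0 // subr0 ltW.
Qed.

(** For either sign e, the function K / l * exp (l s) - e * h s has nonnegative derivative, so it
    stays above its initial value K / l >= 0. *)
Lemma exp_growth (R : realType) (h h' : R -> R) (K l t : R) : 0 < l ->
  (forall t : R, 0 <= t -> is_derive t 1 h (h' t)) -> h 0 = 0 ->
  (forall t, 0 <= t -> `|h' t| <= K * expR (l * t)) ->
  0 <= t -> `|h t| <= K / l * expR (l * t).
Proof.
move=> l0 dh h0 h'K t0.
have K0 : 0 <= K.
  have := h'K 0 (lexx _); rewrite mulr0 expR0 mulr1; exact: le_trans.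
have aux (e : R) : `|e| = 1 -> e * h t <= K / l * expR (l * t).
  move=> e1.
  pose k s := K / l * expR (l * s) - e * h s.
  pose k' s := K * expR (l * s) - e * h' s.
  have dk (s : R) : 0 <= s -> is_derive s 1 k (k' s).
    move=> /dh dhs; have dE := is_derive_expRM l s.
    apply: is_derive_eq; rewrite /k' /GRing.scale /=.
    by field; rewrite gt_eqF.
  have : k 0 <= k t.
    apply: (@ger0_is_derive_le R k k') => //.
    - apply: derivable_within_continuous => s; rewrite in_itv /= => /andP[s0 _].
      by have := dk s s0; case.
    - by move=> s /andP[/ltW /dk].
    - move=> s /andP[/ltW s0 _]; rewrite /k' subr_ge0.
      by apply: le_trans (ler_norm _) _; rewrite normrM e1 mul1r h'K.
  rewrite /k h0 !mulr0 subr0 expR0 mulr1 => kt.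
  have : 0 <= K / l by rewrite divr_ge0 // ltW.
  lra.
rewrite ler_norml; apply/andP; split.
  by have := aux (-1); rewrite normrN1 mulN1r lerNl; apply.
by have := aux 1; rewrite normr1 mul1r; apply.
Qed.

Lemma exists_pow2_le (R : realType) (a e : R) : 0 < e ->
  exists k, a / 2 ^+ k <= e.
Proof.
move=> e0; exists (Num.truncn (a / e)).+1.
rewrite ler_pdivrMr ?exprn_gt0 // mulrC -ler_pdivrMr //.
apply: le_trans (_ : (Num.truncn (a / e)).+1%:R <= _).
  exact/ltW/truncnS_gt.
by rewrite -natrX ler_nat ltnW // ltn_expl.
Qed.

Lemma le0_pow2 (R : realType) (x a : R) :
  (forall k, `|x| <= a / 2 ^+ k) -> x = 0.
Proof.
move=> xa; apply/eqP/negPn/negP; rewrite -normr_gt0 => x0.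
have x20 : 0 < `|x| / 2 by rewrite divr_gt0.
have [k] := exists_pow2_le a x20.
by have := xa k; lra.
Qed.

(** Supplies the pointwise limit of the Picard iterates: the intervals are error bounds around the
    iterates, so the limit comes with its rate. *)
Lemma nested_itv_point (R : realType) (lo hi : nat -> R) :
  (forall k m, lo k <= hi m) -> exists l, forall k, lo k <= l <= hi k.
Proof.
move=> lohi; exists (sup (range lo)) => k; apply/andP; split.
  apply: sup_ubound; last by exists k.
  by exists (hi 0%N) => _ [m _ <-].
apply: ge_sup; first by exists (lo 0%N), 0%N.
by move=> _ [m _ <-].
Qed.

Section Picard.
Context {R : realType} {I : finType}.
Variables (F : (I -> R) -> I -> R) (L : R).
Hypothesis L_gt0 : 0 < L.
Hypothesis F_lip : forall u v (c : R), (forall j, `|u j - v j| <= c) ->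
  forall i, `|F u i - F v i| <= L * c.
Variable x0 : I -> R.

(* Curves matter on [0, +oo[ only; precomposing with the absolute value makes
   continuity there a statement about functions on the whole line. *)
Let curve (x : R -> I -> R) := forall i, continuous (fun s : R => x `|s| i).

(** The Picard operator, sending [x] to [x0] plus the integral of F along [x], as a relation in
    differential form: no integral is handled later. *)
Let step_of (x y : R -> I -> R) := [/\ curve y, y 0 = x0 &
  forall t : R, 0 <= t -> forall i, is_derive t 1 (y^~ i) (F (x t) i)].

Lemma picard_step x : curve x -> exists y, step_of x y.
Proof.
move=> cx.
have cF i : continuous (fun s : R => F (x `|s|) i).
  move=> t; apply/cvgrPdist_le => e e0.
  have : \forall s \near t, forall j, `|x `|t| j - x `|s| j| <= e / L.
    have cxj j : \forall s \near t, `|x `|t| j - x `|s| j| <= e / L.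
      exact: (cvgr_dist_le _ _ (cx j t) _ (divr_gt0 e0 L_gt0)).
    exact: (filter_forall (nbhs_filter t) cxj).
  apply: filterS => s /F_lip /(_ i).
  by rewrite mulrC divfK // gt_eqF.
have /choice[G GE] i : exists G : R -> R,
    G 0 = 0 /\ forall t : R, 0 <= t -> is_derive t 1 G (F (x `|t|) i).
  by have [G G0 dG] := continuous_antiderivative (cF i); exists G.
have dy i (t : R) : 0 <= t ->
    is_derive t 1 (fun s => x0 i + G i s) (F (x t) i).
  move=> t0; have [_ /(_ t t0)] := GE i; rewrite ger0_norm // => dG.
  by apply: is_derive_eq; rewrite add0r mul1r.
exists (fun t i => x0 i + G i t); split.
- move=> i t; apply: (@continuous_comp _ _ _ (fun s : R => `|s|) (fun s => x0 i + G i s)).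
    exact: norm_continuous.
  have := dy i `|t| (normr_ge0 _) => -[+ _].
  by move=> /derivable1_diffP /differentiable_continuous.
- by apply/funext => i; rewrite (GE i).1 addr0.
- by move=> t t0 i; exact: dy.
Qed.

(* The weight [exp (2 L t)] makes the Picard operator a contraction on the whole
   half-line, which yields global solutions without continuation. *)
Lemma picard_contraction x x' y y' (c : R) : step_of x y -> step_of x' y' ->
  (forall t i, 0 <= t -> `|x t i - x' t i| <= c * expR (2 * L * t)) ->
  forall t i, 0 <= t -> `|y t i - y' t i| <= c / 2 * expR (2 * L * t).
Proof.
move=> [_ y0 dy] [_ y'0 dy'] xx' t i t0.
have -> : c / 2 = L * c / (2 * L) by field; rewrite gt_eqF.
apply: (@exp_growth R (fun s => y s i - y' s i)
  (fun s => F (x s) i - F (x' s) i)) => //.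
- by rewrite mulr_gt0.
- by move=> s s0; have := dy s s0 i; have := dy' s s0 i => ? ?; exact: is_deriveB.
- by rewrite y0 y'0 subrr.
- by move=> s s0; rewrite -mulrA; apply: F_lip => j; exact: xx'.
Qed.

(** The iterates converge pointwise to a fixed point [x] of the Picard operator on the half-line.
    The witness is [step x], differentiable by construction, rather than [x], which is known only as
    a limit. *)
Lemma picard_global : exists2 x : R -> I -> R, x 0 = x0 &
  forall t : R, 0 <= t -> forall i, is_derive t 1 (x^~ i) (F (x t) i).
Proof.
(* [step] has to be total to be iterated; where [x] is not a curve its value is unconstrained. *)
have /choice[step stepP] x : exists y, curve x -> step_of x y.
  have [/picard_step[y xy]|nx] := pselect (curve x); first by exists y.
  by exists x.
pose xs k := iter k step (fun=> x0).
have xs_curve k : curve (xs k).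
  elim: k => [|k IH]; first by move=> i; exact: cst_continuous.
  by have [] := stepP _ IH.
pose C := \sum_i `|F x0 i|.
have C0 : 0 <= C by apply: sumr_ge0.
(* The constant that [exp_growth] gives at rate 2 L for the first increment, whose derivative is at
   most [C]. *)
pose c := C / (2 * L).
pose lam := 2 * L.
have lam0 : 0 < lam by rewrite mulr_gt0.
have c0 : 0 <= c by rewrite divr_ge0 // ltW.
have xs1 k t i : 0 <= t ->
    `|xs k.+1 t i - xs k t i| <= c / 2 ^+ k * expR (lam * t).
  elim: k t i => [|k IH] t i t0.
    rewrite expr0 divr1 /c.
    have [_ x10 dx1] := stepP _ (xs_curve 0%N).
    apply: (@exp_growth R (fun s => xs 1%N s i - x0 i) (fun=> F x0 i)) => //.
    - move=> s s0; have := dx1 s s0 i => dx.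
      by apply: is_derive_eq; rewrite subr0.
    - by rewrite [xs 1%N 0]x10 subrr.
    - move=> s s0; apply: le_trans (_ : C <= _).
        by rewrite /C (bigD1 i) //= lerDl sumr_ge0.
      have : 1 <= expR (lam * s) by rewrite -expR0 ler_expR mulr_ge0 // ltW.
      exact: ler_peMr.
  have -> : c / 2 ^+ k.+1 = c / 2 ^+ k / 2.
    by rewrite exprS; field; rewrite expf_neq0 //.
  apply: (picard_contraction (stepP _ (xs_curve k.+1)) (stepP _ (xs_curve k)))
    t0.
  by move=> s j s0; exact: IH.
have xsm k m t i : 0 <= t ->
    `|xs (k + m)%N t i - xs k t i| <= 2 * c / 2 ^+ k * expR (lam * t).
  move=> t0; elim: m k => [|m IH] k.
    rewrite addn0 subrr normr0 mulr_ge0 ?expR_ge0 //.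
    by rewrite divr_ge0 ?exprn_ge0 // mulr_ge0.
  rewrite -addSnnS.
  apply: le_trans (_ : `|xs (k.+1 + m)%N t i - xs k.+1 t i| +
                       `|xs k.+1 t i - xs k t i| <= _).
    by apply: le_trans (ler_normD _ _); rewrite addrA subrK.
  apply: le_trans (lerD (IH k.+1) (xs1 k t i t0)) _.
  rewrite -mulrDl le_eqVlt; apply/orP; left; apply/eqP; congr (_ * _).
  by rewrite exprS; field; rewrite expf_neq0.
have /choice[x xP] t : exists l : I -> R, forall i k, 0 <= t ->
    `|l i - xs k t i| <= 2 * c / 2 ^+ k * expR (lam * t).
  have [t0|t0] := leP 0 t; last by exists (fun=> 0).
  suff /choice[l lP] : forall i, exists l, forall k,
      `|l - xs k t i| <= 2 * c / 2 ^+ k * expR (lam * t) by exists l.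
  move=> i; pose b k := 2 * c / 2 ^+ k * expR (lam * t).
  have b0 k : 0 <= b k by apply: le_trans (xsm k 0%N t i t0).
  have [k m|l lP] := @nested_itv_point R (fun k => xs k t i - b k)
      (fun k => xs k t i + b k).
    have [km|mk] := leqP k m.
      have := xsm k (m - k)%N t i t0; rewrite subnKC // -/(b k) ler_distl.
      by move=> /andP[+ _] => h; apply: le_trans h _; rewrite lerDl.
    have := xsm m (k - m)%N t i t0; rewrite subnKC 1?ltnW // -/(b m) ler_distl.
    by move=> /andP[_ +] => h; apply: le_trans h; rewrite gerBl.
  by exists l => k; rewrite ler_distl lP.
have x_curve : curve x.
  move=> i t; apply/cvgrPdist_le => e e0.
  have e30 : 0 < e / 3 by rewrite divr_gt0.
  (* Up to time |t| + 1 the exponential weight is bounded, so a single iterate is uniformly within e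
     / 3 of [x] and passes its continuity on. *)
  have [k kP] := exists_pow2_le (2 * c * expR (lam * (`|t| + 1))) e30.
  have near1 : \forall s \near t, `|xs k `|t| i - xs k `|s| i| <= e / 3.
    exact: (cvgr_dist_le _ _ (xs_curve k i t) _ e30).
  have near2 : \forall s \near t, `|s| <= `|t| + 1.
    have : \forall s \near t, `|t - s| <= 1.
      exact: (cvgr_dist_le _ _ (@cvg_id _ (nbhs t)) _ ltr01).
    apply: filterS => s; rewrite distrC => h.
    rewrite -[s](subrK t) addrC; apply: le_trans (ler_normD _ _) _.
    by rewrite lerD2l.
  near=> s.
  have kx r : 0 <= r -> r <= `|t| + 1 -> `|x r i - xs k r i| <= e / 3.
    move=> r0 rt; apply: le_trans (xP r i k r0) _; apply: le_trans kP.
    rewrite mulrAC ler_wpM2r ?invr_ge0 ?exprn_ge0 // ler_wpM2l //.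
      by rewrite mulr_ge0.
    by rewrite ler_expR ler_wpM2l // ltW.
  have h1 : `|x `|t| i - xs k `|t| i| <= e / 3 by apply: kx; rewrite ?lerDl.
  have h2 : `|x `|s| i - xs k `|s| i| <= e / 3.
    by apply: kx => //; near: s; exact: near2.
  have h3 : `|xs k `|t| i - xs k `|s| i| <= e / 3 by near: s; exact: near1.
  move: h1 h2 h3; rewrite !ler_norml; lra.
have [y_curve y0 dy] := stepP _ x_curve.
(* At a fixed time, both sides lie within a constant times 2^-k of the iterate of index k + 1. *)
have xy t i : 0 <= t -> step x t i = x t i.
  move=> t0; apply/eqP; rewrite -subr_eq0; apply/eqP.
  apply: (@le0_pow2 _ _ (2 * c * expR (lam * t))) => k.
  have h1 := picard_contraction (stepP _ x_curve) (stepP _ (xs_curve k))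
    (fun t i t0 => xP t i k t0) i t0.
  have h2 := xP t i k.+1 t0.
  have -> : 2 * c * expR (lam * t) / 2 ^+ k =
      2 * c / 2 ^+ k / 2 * expR (lam * t) + 2 * c / 2 ^+ k.+1 * expR (lam * t).
    by rewrite exprS; field; rewrite expf_neq0.
  apply: le_trans (lerD h1 h2); rewrite [X in _ <= _ + X]distrC.
  by apply: le_trans (ler_normD _ _); rewrite addrA subrK.
exists (step x) => // t t0 i.
have -> : step x t = x t by apply/funext => j; exact: xy.
exact: dy.
Unshelve. all: by end_near.
Qed.

End Picard.

(** * Derivatives on the half-line *)

Section HalfLineDerivative.
Context {R : realType}.
Implicit Types (x y z : R -> R) (t d : R).

(** Scalar form of [is_derive_ge0], which unfolds to it coordinate by coordinate. *)
Definition deriv_ge0 x t d : Prop :=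
  (x s - x t) / (s - t) @[s --> within [set s | 0 <= s] t^'] --> d.

Lemma deriv_ge0P x t d : deriv_ge0 x t d <->
  (forall e, 0 < e -> exists2 r, 0 < r & forall s, 0 <= s -> s != t ->
     `|s - t| < r -> `|d - (x s - x t) / (s - t)| <= e).
Proof.
split.
  move=> /cvgrPdist_le xd e /xd [r /= r0 rP]; exists r => // s s0 st str.
  by apply: rP => //=; rewrite 1?distrC // 1?eq_sym.
move=> xd; apply/cvgrPdist_le => e /xd [r r0 rP].
exists r => //= s; rewrite /ball_ /= => str ts s0.
by apply: rP => //; rewrite 1?distrC // eq_sym.
Qed.

Lemma is_deriveP x t d : is_derive t 1 x d <->
  (forall e, 0 < e -> exists2 r, 0 < r & forall s, s != t ->
     `|s - t| < r -> `|d - (x s - x t) / (s - t)| <= e).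
Proof.
have E : is_derive t 1 x d <->
    h^-1 *: (x (h *: 1 + t) - x t) @[h --> 0^'] --> d.
  split=> [[xt <-]|xd]; first exact: xt.
  split; first by apply/cvg_ex; exists d.
  exact/cvg_lim.
rewrite E; split.
  move=> /cvgrPdist_le xd e /xd [r /= r0 rP]; exists r => // s st str.
  have := rP (s - t); rewrite /ball_ /= sub0r normrN => /(_ str).
  rewrite subr_eq0 => /(_ st); rewrite /GRing.scale /= mulr1 subrK.
  by rewrite mulrC.
move=> xd; apply/cvgrPdist_le => e /xd [r r0 rP].
exists r => //= h; rewrite /ball_ /= sub0r normrN => hr h0.
have := rP (h + t); rewrite addrK => /(_ _ hr).
rewrite /GRing.scale /= mulr1 mulrC; apply.
by rewrite -subr_eq0 addrK.
Qed.

Lemma is_derive_deriv_ge0 x t d : is_derive t 1 x d -> deriv_ge0 x t d.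
Proof.
move=> /is_deriveP xd; apply/deriv_ge0P => e /xd[r r0 rP].
by exists r => // s _; exact: rP.
Qed.

Lemma deriv_gt0_is_derive x t d : 0 < t -> deriv_ge0 x t d -> is_derive t 1 x d.
Proof.
move=> t0 /deriv_ge0P xd; apply/is_deriveP => e /xd[r r0 rP].
(* Capping the radius by [t] keeps [s] in the half-line. *)
exists (Num.min r t); first by rewrite lt_min r0.
move=> s st; rewrite lt_min => /andP[str stt]; apply: rP => //.
by move: stt; rewrite ltr_norml; lra.
Qed.

(** At a point slightly to the right of [t] the two difference quotients are equal, yet within |d -
    d'| / 3 of [d] and [d'] respectively. This differentiates identities that are known on the
    half-line only, even at 0. *)
Lemma deriv_ge0_unique x y t d d' : 0 <= t -> (forall s, 0 <= s -> x s = y s) ->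
  deriv_ge0 x t d -> deriv_ge0 y t d' -> d = d'.
Proof.
move=> t0 xy /deriv_ge0P xd /deriv_ge0P yd.
apply/eqP; rewrite -subr_eq0 -normr_eq0; apply/negPn/negP => dd.
have dd0 : 0 < `|d - d'| / 3 by rewrite divr_gt0 // lt_neqAle eq_sym dd normr_ge0.
have [r r0 rP] := xd _ dd0; have [r' r'0 r'P] := yd _ dd0.
pose s := t + Num.min r r' / 2.
have m0 : 0 < Num.min r r' by rewrite lt_min r0.
have st : t < s by rewrite ltrDl divr_gt0.
have s0 : 0 <= s by apply: le_trans (ltW st).
have nst : `|s - t| = Num.min r r' / 2.
  by rewrite addrAC subrr add0r gtr0_norm // divr_gt0.
have lst : Num.min r r' / 2 < Num.min r r' by rewrite ltr_pdivrMr // ltr_pMr // ltr1n.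
have st' : s != t by rewrite gt_eqF.
have mr : `|s - t| < r by rewrite nst (lt_le_trans lst) // ge_min lexx.
have mr' : `|s - t| < r' by rewrite nst (lt_le_trans lst) // ge_min lexx orbT.
have h1 := rP s s0 st' mr; have := r'P s s0 st' mr'.
rewrite -!xy // => h2.
have : `|d - d'| <= `|d - d'| / 3 + `|d - d'| / 3.
  apply: le_trans (lerD h1 h2); rewrite [X in _ <= _ + X]distrC.
  by apply: le_trans (ler_normD _ _); rewrite addrA subrK.
have : 0 < `|d - d'| by rewrite lt_neqAle eq_sym dd normr_ge0.
lra.
Qed.

Lemma deriv_ge0B x y t d d' : deriv_ge0 x t d -> deriv_ge0 y t d' ->
  deriv_ge0 (fun s => x s - y s) t (d - d').
Proof.
move=> xd yd; apply: cvg_trans (cvgB xd yd).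
by apply: near_eq_cvg; apply: nearW => s; rewrite /= !fctE -mulrBl; congr (_ * _); ring.
Qed.

Lemma deriv_ge0_within x t0 T : 0 < T ->
  (forall t, 0 <= t -> exists d, deriv_ge0 x t d) ->
  {within `[0, T], continuous x}.
Proof.
move=> T0 dx; have cx t : 0 < t -> {for t, continuous x}.
  move=> t_gt0; have [d] := dx t (ltW t_gt0).
  move=> /(deriv_gt0_is_derive t_gt0) [+ _].
  by move=> /derivable1_diffP /differentiable_continuous.
apply/continuous_within_itvP => //; split.
- by move=> t; rewrite in_itv /= => /andP[/cx].
(* At 0, right continuity follows from the bound |d| + 1 on nearby difference quotients. *)
- have [d /deriv_ge0P xd] := dx 0 (lexx _).
  have [r r0 rP] := xd 1 ltr01.
  apply/cvgrPdist_le => e e0.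
  have K0 : 0 < `|d| + 1 by rewrite ltr_wpDl.
  near=> s.
  have s0 : 0 < s by near: s; exact: nbhs_right_gt.
  have sr : s < r by near: s; exact: nbhs_right_lt.
  have se : s < e / (`|d| + 1) by near: s; apply: nbhs_right_lt; rewrite divr_gt0.
  have := rP s (ltW s0) (negbT (gt_eqF s0)); rewrite subr0 gtr0_norm // => /(_ sr) h.
  rewrite distrC -[x s - x 0](divfK (negbT (gt_eqF s0))) normrM [`|s|]gtr0_norm //.
  apply: le_trans (_ : (`|d| + 1) * s <= _); last first.
    by rewrite mulrC -ler_pdivlMr // ltW.
  apply: ler_wpM2r; first exact: ltW.
  rewrite -[X in `|X|](subrK d) addrC.
  by apply: le_trans (ler_normD _ _) _; rewrite lerD2l distrC.
- by apply: cvg_at_left_filter; exact: cx.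
Unshelve. all: by end_near.
Qed.

(* Energy argument: [(y^2 + z^2) exp (- mu t)] is nonincreasing. *)
Lemma second_order_gronwall y z z' K : 0 <= K ->
  (forall t, 0 <= t -> deriv_ge0 y t (z t)) ->
  (forall t, 0 <= t -> deriv_ge0 z t (z' t)) ->
  (forall t, 0 <= t -> `|z' t| <= K * (`|y t| + `|z t|)) ->
  y 0 = 0 -> z 0 = 0 -> forall t, 0 <= t -> y t = 0.
Proof.
move=> K0 dy dz z'K y0 z0 T; rewrite le_eqVlt => /predU1P[<-//|T0].
(* Since 2yz <= y^2 + z^2 and 2|z||z'| <= K (y^2 + 3 z^2), the energy y^2 + z^2 grows at rate at
   most 1 + 3K. The minus sign in [h] makes it nondecreasing, as [ger0_is_derive_le] expects. *)
pose mu := - (1 + 3 * K).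
pose h t := - (y t * y t + z t * z t) * expR (mu * t).
pose h' t := - (2 * (y t * z t) + 2 * (z t * z' t)) * expR (mu * t)
  - (y t * y t + z t * z t) * (mu * expR (mu * t)).
have cy : {within `[0, T], continuous y}.
  by apply: deriv_ge0_within => // t /dy dyt; exists (z t).
have cz : {within `[0, T], continuous z}.
  by apply: deriv_ge0_within => // t /dz dzt; exists (z' t).
have ce : {within `[0, T], continuous (fun t => expR (mu * t))}.
  apply: derivable_within_continuous => t _.
  by have [] := is_derive_expRM mu t.
have : h 0 <= h T.
  apply: (@ger0_is_derive_le R h h') => //; first exact: ltW.
  - have cyz : {within `[0, T], continuous (fun t => y t * y t + z t * z t)}.
      move=> t; apply: cvgD; apply: cvgM; by [exact: cy|exact: cz].
    by move=> t; apply: cvgM; [apply: cvgN; exact: cyz|exact: ce].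
  - move=> t /andP[t0 _].
    have dyt := deriv_gt0_is_derive t0 (dy t (ltW t0)).
    have dzt := deriv_gt0_is_derive t0 (dz t (ltW t0)).
    have det := is_derive_expRM mu t.
    apply: is_derive_eq; rewrite /h' /GRing.scale /=; ring.
  - move=> t /andP[/ltW t0 _]; have := z'K t t0.
    have -> : h' t = (- (2 * (y t * z t) + 2 * (z t * z' t))
        - (y t * y t + z t * z t) * mu) * expR (mu * t) by rewrite /h'; ring.
    move=> zK; apply: mulr_ge0; last exact: expR_ge0.
    have h1 : 2 * (y t * z t) <= y t * y t + z t * z t.
      have : 0 <= (y t - z t) ^+ 2 by exact: sqr_ge0.
      rewrite expr2; lra.
    have h2 : z t * z' t <= `|z t| * (K * (`|y t| + `|z t|)).
      apply: le_trans (ler_norm _) _; rewrite normrM; exact: ler_wpM2l.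
    have sqE (r : R) : r * r = `|r| * `|r|.
      by rewrite -normrM ger0_norm // -expr2 sqr_ge0.
    have h3 : 0 <= K * (`|y t| - `|z t|) ^+ 2 by rewrite mulr_ge0 // sqr_ge0.
    have h4 : 0 <= K * (`|y t| * `|y t|) by rewrite !mulr_ge0.
    move: h1 h2 h3 h4; rewrite /mu expr2 (sqE (y t)) (sqE (z t)).
    by move: (`|y t|) (`|z t|) (y t * z t) (z t * z' t) => a b p q; lra.
rewrite /h y0 z0 !mulr0 addr0 oppr0 mul0r.
rewrite mulNr oppr_ge0 pmulr_lle0 ?expR_gt0 // => hT.
apply/eqP; rewrite -sqrf_eq0 eq_le sqr_ge0 andbT expr2.
by apply: le_trans hT; rewrite lerDl -expr2 sqr_ge0.
Qed.

End HalfLineDerivative.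

(** * Minimum principle and Kron reduction *)

Lemma unitmx_ker0 (F : fieldType) (n : nat) (A : 'M[F]_n) :
  (forall v : 'cV[F]_n, A *m v = 0 -> v = 0) -> A \in unitmx.
Proof.
move=> Ainj; rewrite -unitmx_tr unitmxE unitfE; apply/det0P => -[v v0 vA].
move/negP: v0; apply; apply/eqP; apply: trmx_inj; rewrite trmx0.
by apply: Ainj; apply: trmx_inj; rewrite trmx_mul trmxK trmx0.
Qed.

Section SchurComplement.
Context {F : fieldType} {n m : nat}.
Variables (D K11 : 'M[F]_n) (K12 : 'M[F]_(n, m)) (K22 : 'M[F]_m).

Definition schur : 'M[F]_n := D + K11 - K12 *m invmx K22 *m K12^T.

(** The lower block row determines [b] from [a], as [K22] is invertible; substituting it into the
    upper row leaves [schur *m a = D *m d]. *)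
Lemma schur_solve (d a : 'cV[F]_n) (b : 'cV[F]_m) :
  K22 \in unitmx -> schur \in unitmx ->
  col_mx (D *m (d - a)) 0 = block_mx K11 K12 K12^T K22 *m col_mx a b <->
  a = invmx schur *m D *m d /\ b = - (invmx K22 *m K12^T *m a).
Proof.
move=> K22u Su; rewrite mul_block_col; split.
  move/eq_col_mx => [e1 e2].
  have bE : b = - (invmx K22 *m K12^T *m a).
    rewrite -[b](mulKmx K22u); move/eqP: e2; rewrite eq_sym addrC addr_eq0.
    by move/eqP->; rewrite mulmxN mulmxA.
  split=> //; rewrite -mulmxA -[a in LHS](mulKmx Su); congr (_ *m _).
  move/eqP: e1; rewrite mulmxBr subr_eq => /eqP->.
  rewrite /schur bE !mulmxBl !mulmxDl mulmxN !mulmxA.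
  by rewrite [in RHS]addrC addrA.
move=> [aE bE].
have e1 : schur *m a = D *m d by rewrite aE -!mulmxA mulKVmx.
congr col_mx.
  apply/eqP; rewrite mulmxBr subr_eq -e1 bE; apply/eqP.
  rewrite /schur !mulmxBl !mulmxDl mulmxN !mulmxA.
  by rewrite [in RHS]addrC addrA.
by rewrite bE mulmxN -!mulmxA mulKVmx // subrr.
Qed.

End SchurComplement.

(** * The network Laplacian and the positivity of the voltage response *)

Section Network.
Context {R : realType} {n nb : nat}.
Variable S : power_system R n nb.
Hypothesis n_gt0 : (0 < n)%N.

Let suscC : forall i j, susceptance S i j = susceptance S j i.
Proof.
move=> i j; rewrite /susceptance adjacent_sym; case: ifP => // a.
by rewrite line_reactance_sym // adjacent_sym.
Qed.

Let susc_ge0 i j : 0 <= susceptance S i j.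
Proof.
by rewrite /susceptance; case: ifP => // /(line_reactance_gt0) /ltW; rewrite invr_ge0.
Qed.

Let susc_gt0 i j : Defs.adjacent S i j -> 0 < susceptance S i j.
Proof.
by move=> a; rewrite /susceptance a invr_gt0 (line_reactance_gt0 a).
Qed.

Lemma laplacian_tr : (laplacian S)^T = laplacian S.
Proof.
apply/matrixP => i j; rewrite !mxE eq_sym; case: eqP => [->//|_].
by rewrite suscC.
Qed.

Lemma laplacian_block :
  laplacian S = block_mx (L11 S) (L12 S) (L12 S)^T (L22 S).
Proof.
rewrite -[LHS]submxK; congr block_mx.
by rewrite /L12 trmx_ursub laplacian_tr.
Qed.

Lemma L22_tr : (L22 S)^T = L22 S.
Proof. by rewrite /L22 trmx_drsub laplacian_tr. Qed.

Lemma L11_tr : (L11 S)^T = L11 S.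
Proof. by rewrite /L11 trmx_ulsub laplacian_tr. Qed.

(** Vanishing row sums turn each row into a sum of currents driven by voltage differences. *)
Lemma laplacian_mulE (x : 'cV[R]_(n + nb)) v :
  (laplacian S *m x) v 0 = \sum_k susceptance S v k * (x v 0 - x k 0).
Proof.
rewrite mxE (bigD1 v) //= !mxE eqxx [RHS](bigD1 v) //= subrr mulr0 add0r.
rewrite mulr_suml -big_split; apply: eq_bigr => k kv.
by rewrite !mxE eq_sym (negPf kv) mulrBr mulNr.
Qed.

Lemma laplacian_const (x : 'cV[R]_(n + nb)) m :
  (forall v, x v 0 = m) -> laplacian S *m x = 0.
Proof.
move=> xm; apply/colP => v; rewrite laplacian_mulE mxE.
by apply: big1 => k _; rewrite !xm subrr mulr0.
Qed.

Lemma laplacian_min_le0 (x : 'cV[R]_(n + nb)) v :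
  (forall k, x v 0 <= x k 0) -> (laplacian S *m x) v 0 <= 0.
Proof.
move=> xv; rewrite laplacian_mulE; apply: sumr_le0 => k _.
by rewrite mulr_ge0_le0 // subr_le0.
Qed.

(** At a bus of minimal value every term of the Laplacian row is at most 0 while their sum is at
    least 0, so the neighbours have the same value; connectedness spreads it along a path. *)
Lemma minimum_principle (x : 'cV[R]_(n + nb)) m u :
  (forall v, m <= x v 0) ->
  (forall v, x v 0 = m -> 0 <= (laplacian S *m x) v 0) ->
  x u 0 = m -> forall v, x v 0 = m.
Proof.
move=> mx Lx xu v.
have adj k l : Defs.adjacent S k l -> x k 0 = m -> x l 0 = m.
  move=> akl xk; have := Lx k xk; rewrite laplacian_mulE.
  rewrite (bigD1 l) //= => h.
  have h2 : \sum_(i < n + nb | i != l) susceptance S k i * (x k 0 - x i 0) <= 0.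
    by apply: sumr_le0 => i _; rewrite mulr_ge0_le0 // subr_le0 xk.
  have : 0 <= susceptance S k l * (x k 0 - x l 0).
    by apply: le_trans h _; rewrite gerDl.
  rewrite pmulr_rge0 ?susc_gt0 // subr_ge0 xk => h3.
  by apply/eqP; rewrite eq_le h3 mx.
have /connectP[p] := adjacent_connected S u v.
elim: p u xu => [|w p IH] u xu /=; first by move=> _ ->.
move=> /andP[uw pth] vE; apply: (IH w) => //; exact: adj uw xu.
Qed.

(** A negative minimum would make [x] constant by the minimum principle, so its Laplacian would
    vanish, against the strict inequality at [u]. *)
Lemma nonneg_principle (x : 'cV[R]_(n + nb)) u :
  (forall v, x v 0 < 0 -> 0 <= (laplacian S *m x) v 0) ->
  (x u 0 < 0 -> 0 < (laplacian S *m x) u 0) ->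
  forall v, 0 <= x v 0.
Proof.
move=> Lx Lu v.
have [w _ wmin] := @Order.TotalTheory.arg_minP _ _ _ u xpredT (fun v => x v 0) isT.
apply: le_trans (wmin v isT); rewrite leNgt; apply/negP => xw0.
have xw : forall v, x v 0 = x w 0.
  apply: (@minimum_principle x (x w 0) w) => //; first by move=> k; exact: wmin.
  by move=> k kw; apply: Lx; rewrite kw.
have := Lu; rewrite (laplacian_const xw) xw mxE ltxx => /(_ xw0).
by [].
Qed.

(** A kernel vector, extended by 0 to the generator buses, is nonnegative by [nonneg_principle],
    with [u] a generator bus; so is its opposite. *)
Lemma L22_unit : L22 S \in unitmx.
Proof.
have ker_ge0 (y : 'cV[R]_nb) : L22 S *m y = 0 -> forall k, 0 <= y k 0.
  move=> y0 k.
  have Lx : laplacian S *m col_mx 0 y = col_mx (L12 S *m y) 0.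
    by rewrite laplacian_block mul_block_col !mulmx0 !add0r y0.
  have := @nonneg_principle (col_mx 0 y) (lshift nb (Ordinal n_gt0)) _ _ (rshift n k).
  rewrite col_mxEd; apply; last by rewrite col_mxEu mxE ltxx.
  move=> v; case: (split_ordP v) => i ->; first by rewrite col_mxEu mxE ltxx.
  by rewrite Lx !col_mxEd [in X in _ -> X]mxE.
apply: unitmx_ker0 => y y0; apply/colP => k; rewrite mxE.
apply/eqP; rewrite eq_le (ker_ge0 y y0) andbT -oppr_ge0.
by have := @ker_ge0 (- y); rewrite mulmxN y0 oppr0 => /(_ erefl k); rewrite mxE.
Qed.

Definition reduced_mx := schur (LD S) (L11 S) (L12 S) (L22 S).

(* Locked so that [mxE] does not expand the entries of the product. *)
Fact response_key : unit. Proof. by []. Qed.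
Definition response : 'M[R]_n :=
  locked_with response_key (invmx reduced_mx *m LD S).

Lemma responseE : response = invmx reduced_mx *m LD S.
Proof. by rewrite /response unlock. Qed.

Lemma GammaE : Gamma S = LD S *m response.
Proof. by rewrite /Gamma responseE mulmxA. Qed.

Lemma LD_mulE (a : 'cV[R]_n) i : (LD S *m a) i 0 = (gen_reactance S i 0)^-1 * a i 0.
Proof. by rewrite /LD /cdiag_mx mul_diag_mx !mxE. Qed.

Let chiV_gt0 i : 0 < (gen_reactance S i 0)^-1.
Proof. by rewrite invr_gt0 gen_reactance_gt0. Qed.

(** A generator bus of negative voltage draws positive current from its internal source, and a
    non-generator bus draws none, so [nonneg_principle] applies. *)
Lemma balance_ge0 (d a : 'cV[R]_n) b : (forall i, 0 <= d i 0) ->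
  col_mx (LD S *m (d - a)) 0 = laplacian S *m col_mx a b ->
  forall v, 0 <= col_mx a b v 0.
Proof.
move=> d0 E v.
have gen i : a i 0 < 0 -> 0 < (laplacian S *m col_mx a b) (lshift nb i) 0.
  move=> ai; rewrite -E col_mxEu LD_mulE mulr_gt0 //.
  rewrite !mxE; have := d0 i; lra.
apply: (@nonneg_principle _ (lshift nb (Ordinal n_gt0))).
  move=> w; case: (split_ordP w) => i ->.
    by rewrite col_mxEu => /gen /ltW.
  by rewrite -E !col_mxEd => _; rewrite mxE.
by rewrite col_mxEu; exact: gen.
Qed.

(** A kernel vector gives a balanced state with zero internal voltages; by [balance_ge0] both it and
    its opposite are nonnegative. *)
Lemma reduced_mx_unit : reduced_mx \in unitmx.
Proof.
have ker_ge0 (a : 'cV[R]_n) : reduced_mx *m a = 0 -> forall i, 0 <= a i 0.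
  move=> a0 i.
  have := @balance_ge0 0 a (- (invmx (L22 S) *m (L12 S)^T *m a)) _ _ (lshift nb i).
  rewrite col_mxEu; apply; first by move=> j; rewrite mxE.
  rewrite laplacian_block mul_block_col; congr col_mx.
    move: a0; rewrite /reduced_mx /schur !mulmxBl !mulmxDl => a0.
    apply/eqP; rewrite sub0r mulmxN eq_sym -addr_eq0 mulmxN !mulmxA.
    by rewrite addrC addrA a0.
  by rewrite mulmxN -!mulmxA mulKVmx ?L22_unit // subrr.
apply: unitmx_ker0 => y y0; apply/colP => k; rewrite mxE.
apply/eqP; rewrite eq_le (ker_ge0 y y0) andbT -oppr_ge0.
by have := @ker_ge0 (- y); rewrite mulmxN y0 oppr0 => /(_ erefl k); rewrite mxE.
Qed.

(** Identifies [response] as the map from internal generator voltages to generator bus voltages. *)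
Lemma response_solve (d a : 'cV[R]_n) b :
  col_mx (LD S *m (d - a)) 0 = laplacian S *m col_mx a b <->
  a = response *m d /\ b = - (invmx (L22 S) *m (L12 S)^T *m a).
Proof.
rewrite laplacian_block responseE; exact: schur_solve L22_unit reduced_mx_unit.
Qed.

(** With all internal voltages equal to 1, the constant profile 1 carries no current and balances
    the network. *)
Lemma response_const1 : response *m const_mx 1 = const_mx 1 :> 'cV_n.
Proof.
have [h _] := response_solve (const_mx 1) (const_mx 1) (const_mx 1).
have [] := h => //.
rewrite subrr mulmx0 col_mx0 (@laplacian_const _ 1) // => v.
by rewrite col_mx_const mxE.
Qed.

Lemma response_row_sum i : \sum_k response i k = 1.
Proof.
have /colP/(_ i) := response_const1; rewrite !mxE => <-.
by apply: eq_bigr => k _; rewrite [const_mx _ _ _]mxE mulr1.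
Qed.

(** Column j is the generator part of the voltage profile produced by a unit source at generator j;
    [b] extends it to all buses, where the minimum principle applies. *)
Let column (j : 'I_n) : exists b : 'cV[R]_nb, 
  let x := col_mx (col j response) b in
  col_mx (LD S *m (delta_mx j 0 - col j response)) 0 = laplacian S *m x.
Proof.
exists (- (invmx (L22 S) *m (L12 S)^T *m col j response)).
by apply/response_solve; rewrite colE.
Qed.

(** A zero entry would be a minimum of the nonnegative profile of column j, which would then vanish
    everywhere; but bus j receives current from its unit source. *)
Lemma response_gt0 i j : 0 < response i j.
Proof.
have [b E] := column j; set x := col_mx _ _ in E.
have x0 : forall v, 0 <= x v 0.
  by apply: balance_ge0 E => k; rewrite mxE; case: (_ && _).
have xi : x (lshift nb i) 0 = response i j by rewrite col_mxEu mxE.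
have := x0 (lshift nb i); rewrite le_eqVlt xi => /predU1P[ri0|//].
have xE := @minimum_principle x 0 (lshift nb i) x0.
have {}xE : forall v, x v 0 = 0.
  apply: xE; last by rewrite xi.
  move=> v; rewrite -E; case: (split_ordP v) => k ->.
    rewrite !col_mxEu LD_mulE !mxE => ->; rewrite subr0.
    by rewrite mulr_ge0 ?ler0n // ltW.
  by rewrite !col_mxEd [in X in _ -> X]mxE.
have /colP/(_ (lshift nb j)) := E.
have xj := xE (lshift nb j); rewrite col_mxEu mxE in xj.
rewrite (laplacian_const xE) col_mxEu LD_mulE !mxE !eqxx xj subr0 mulr1 => /eqP.
by rewrite gt_eqF.
Qed.

(** Let y be the diagonal entry minus the profile of column j. Its Laplacian is nonnegative away
    from bus j, and y vanishes at j, so y >= 0. A zero at i would be a minimum, where the Laplacian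
    is at most 0, whereas its value there is response_ij / chi_i > 0. *)
Lemma response_lt_diag i j : i != j -> response i j < response j j.
Proof.
move=> ij.
have [b E] := column j; set x := col_mx _ _ in E.
pose y : 'cV[R]_(n + nb) := const_mx (response j j) - x.
have Ly : laplacian S *m y = - (laplacian S *m x).
  rewrite mulmxBr (@laplacian_const (const_mx _) (response j j)) ?sub0r //.
  by move=> v; rewrite mxE.
have yg k : y (lshift nb k) 0 = response j j - response k j.
  by rewrite /y mxE [const_mx _ _ _]mxE [(- x) _ _]mxE /x col_mxEu mxE.
have Lyg k : k != j -> (laplacian S *m y) (lshift nb k) 0 =
    (gen_reactance S k 0)^-1 * response k j.
  by move=> kj; rewrite Ly -E mxE col_mxEu LD_mulE !mxE (negPf kj) /= add0r mulrN opprK.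
have y0 : forall v, 0 <= y v 0.
  apply: (@nonneg_principle _ (lshift nb j)); last by rewrite yg subrr ltxx.
  move=> v; case: (split_ordP v) => k ->.
    rewrite yg; have [->|kj] := eqVneq k j; first by rewrite subrr ltxx.
    by rewrite Lyg // => _; rewrite mulr_ge0 // ltW // response_gt0.
  by move=> _; rewrite Ly -E mxE col_mxEd mxE oppr0.
have := y0 (lshift nb i); rewrite yg subr_ge0 le_eqVlt => /predU1P[e|//].
have : (laplacian S *m y) (lshift nb i) 0 <= 0.
  by apply: laplacian_min_le0 => k; rewrite yg e subrr y0.
by rewrite Lyg // leNgt mulr_gt0 // response_gt0.
Qed.

Lemma Gamma_tr : (Gamma S)^T = Gamma S.
Proof.
have LDt : (LD S)^T = LD S by rewrite /LD /cdiag_mx tr_diag_mx.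
rewrite /Gamma !trmx_mul LDt trmx_inv mulmxA; congr (_ *m invmx _ *m _).
rewrite !linearB /= !linearD /= LDt L11_tr !trmx_mul trmxK trmx_inv L22_tr.
by rewrite mulmxA.
Qed.

Lemma Gamma_entry i k : Gamma S i k = (gen_reactance S i 0)^-1 * response i k.
Proof. by rewrite GammaE /LD /cdiag_mx mul_diag_mx !mxE. Qed.

End Network.

(** * Sine bounds and polar coordinates *)

Lemma sin_lipschitz (R : realType) (a b : R) : `|sin a - sin b| <= `|a - b|.
Proof.
wlog ba : a b / b <= a.
  move=> H; have [/H//|/ltW /H] := leP b a.
  by rewrite distrC [`|b - a|]distrC.
have cs : {within `[b, a], continuous (@sin R)}.
  by apply: derivable_within_continuous => x _; exact: derivable_sin.
have [c _ ->] := MVT_segment ba (fun x _ => is_derive_sin x) cs.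
by rewrite normrM ler_piMl // ler_norml cos_geN1 cos_le1.
Qed.

(** Turns rectangular voltages into an amplitude and a phase. The arccosine yields an angle of
    nonnegative sine, so its sign is flipped when b < 0. *)
Lemma polar (R : realType) (a b : R) :
  exists p : R * R, [/\ 0 <= p.1, p.1 * cos p.2 = a & p.1 * sin p.2 = b].
Proof.
have [r0|r0] := eqVneq (a ^+ 2 + b ^+ 2) 0.
  exists (0, 0) => /=; rewrite !mul0r.
  move/eqP: r0; rewrite paddr_eq0 ?sqr_ge0 // !sqrf_eq0.
  by case/andP=> /eqP-> /eqP->.
pose r := Num.sqrt (a ^+ 2 + b ^+ 2).
have s0 : 0 <= a ^+ 2 + b ^+ 2 by rewrite addr_ge0 ?sqr_ge0.
have rgt0 : 0 < r by rewrite sqrtr_gt0 lt_neqAle eq_sym r0.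
have r2 : r ^+ 2 = a ^+ 2 + b ^+ 2 by rewrite sqr_sqrtr.
have ar : -1 <= a / r <= 1.
  rewrite -ler_norml normrM normfV [`|r|]gtr0_norm // ler_pdivrMr // mul1r.
  by rewrite -sqrtr_sqr ler_sqrt // lerDl sqr_ge0.
have cE : r * cos (acos (a / r)) = a by rewrite acosK ?in_itv //= mulrC divfK ?gt_eqF.
have sE : r * sin (acos (a / r)) = `|b|.
  rewrite sin_acos // -[X in X * _](gtr0_norm rgt0) -sqrtr_sqr.
  rewrite -sqrtrM ?sqr_ge0 // -[RHS]sqrtr_sqr; congr Num.sqrt.
  have -> : r ^+ 2 * (1 - (a / r) ^+ 2) = r ^+ 2 - a ^+ 2.
    by field; rewrite gt_eqF.
  by rewrite r2; ring.
have [b0|b0] := leP 0 b.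
  by exists (r, acos (a / r)); split => //=; rewrite ?ltW // sE ger0_norm.
exists (r, - acos (a / r)); split => /=; rewrite ?ltW ?cosN //.
by rewrite sinN mulrN sE ltr0_norm // opprK.
Qed.

(** * Kron reduction of the complex network equations *)

Section Reduction.
Context {R : realType} {n nb : nat}.
Variable S : power_system R n nb.
Hypothesis n_gt0 : (0 < n)%N.

(** The interaction term of the Kron-reduced swing equation. *)
Definition coupling (delta : 'cV[R]_n) (k : 'I_n) : R :=
  \sum_l Gamma S k l * emf S k 0 * emf S l 0 * sin (delta k 0 - delta l 0).

(** All coefficients are real, and the embedding of the reals into the complex numbers commutes with
    products, inverses and Schur complements. *)
Lemma complex_response_solve (d a : 'cV[R[i]]_n) (b : 'cV[R[i]]_nb) :
  col_mx (complex_mx (LD S) *m (d - a)) 0 =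
    block_mx (complex_mx (L11 S)) (complex_mx (L12 S))
             (complex_mx (L12 S)^T) (complex_mx (L22 S)) *m col_mx a b <->
  a = complex_mx (response S) *m d /\
  b = - (invmx (complex_mx (L22 S)) *m (complex_mx (L12 S))^T *m a).
Proof.
have sE : schur (complex_mx (LD S)) (complex_mx (L11 S)) (complex_mx (L12 S))
    (complex_mx (L22 S)) = complex_mx (reduced_mx S).
  rewrite /schur /reduced_mx /schur /complex_mx.
  by rewrite map_mxB map_mxD !map_mxM map_invmx map_trmx.
have rE : complex_mx (response S) = invmx (complex_mx (reduced_mx S)) *m complex_mx (LD S).
  by rewrite responseE /complex_mx map_mxM map_invmx.
have -> : complex_mx (L12 S)^T = (complex_mx (L12 S))^T by rewrite /complex_mx map_trmx.
rewrite rE -sE; apply: schur_solve.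
  by rewrite /complex_mx map_unitmx L22_unit.
by rewrite sE /complex_mx map_unitmx reduced_mx_unit.
Qed.

Lemma phasor_responseP (V theta E delta : 'cV[R]_n) :
  phasor V theta = complex_mx (response S) *m phasor E delta <->
  forall k,
    V k 0 * cos (theta k 0) = \sum_l response S k l * (E l 0 * cos (delta l 0)) /\
    V k 0 * sin (theta k 0) = \sum_l response S k l * (E l 0 * sin (delta l 0)).
Proof.
have cE k : (complex_mx (response S) *m phasor E delta) k 0 =
   (\sum_l response S k l * (E l 0 * cos (delta l 0))) +i*
   (\sum_l response S k l * (E l 0 * sin (delta l 0))).
  rewrite mxE; apply/eqP; rewrite eq_complex !raddf_sum /=.
  apply/andP; split; apply/eqP; apply: eq_bigr => l _; rewrite !mxE /=.
    by rewrite mul0r subr0.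
  by rewrite mul0r addr0.
split=> [/colP h k|h].
  by have := h k; rewrite cE mxE => -[].
by apply/colP => k; rewrite cE mxE; have [-> ->] := h k.
Qed.

(** Expanding the sine of the difference leaves [V] and [theta] only through V cos theta and V sin
    theta, which are linear in the internal voltages. *)
Lemma power_coupling (V theta delta : 'cV[R]_n) :
  phasor V theta = complex_mx (response S) *m phasor (emf S) delta ->
  forall k, emf S k 0 * V k 0 / gen_reactance S k 0
    * sin (delta k 0 - theta k 0) = coupling delta k.
Proof.
move/phasor_responseP => h k; have [hc hs] := h k.
rewrite /coupling sinB.
transitivity (emf S k 0 / gen_reactance S k 0 *
  (sin (delta k 0) * (V k 0 * cos (theta k 0)) -
   cos (delta k 0) * (V k 0 * sin (theta k 0)))); first by ring.
rewrite hc hs !mulr_sumr -sumrB mulr_sumr; apply: eq_bigr => l _.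
by rewrite Gamma_entry sinB; ring.
Qed.

Lemma swing_entry (alpha omega delta V theta : 'cV[R]_n) :
  phasor V theta = complex_mx (response S) *m phasor (emf S) delta ->
  inertia_mx S *m alpha + damping_mx S *m omega =
    injection S - \col_k (emf S k 0 * V k 0 / gen_reactance S k 0
                          * sin (delta k 0 - theta k 0)) <->
  forall k, inertia S k 0 * alpha k 0 + damping S k 0 * omega k 0 =
            injection S k 0 - coupling delta k.
Proof.
move=> Vr.
have E k : (inertia_mx S *m alpha + damping_mx S *m omega) k 0 =
   inertia S k 0 * alpha k 0 + damping S k 0 * omega k 0.
  by rewrite mxE /inertia_mx /damping_mx /cdiag_mx !mul_diag_mx !mxE.
split=> [/colP h k|h].
  by have := h k; rewrite E !mxE power_coupling.
by apply/colP => k; rewrite E h !mxE power_coupling.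
Qed.

End Reduction.

(** * Synchronization *)

Section Solutions.
Context {R : realType} {n nb : nat}.
Variable S : power_system R n nb.
Hypothesis n_gt0 : (0 < n)%N.

Definition acceleration (delta omega : 'cV[R]_n) (k : 'I_n) : R :=
  (injection S k 0 - coupling S delta k - damping S k 0 * omega k 0)
  / inertia S k 0.

(** The sine is 1-Lipschitz and its argument involves two phases, whence the factor 2. *)
Lemma coupling_lipschitz (d d' : 'cV[R]_n) c k :
  (forall j, `|d j 0 - d' j 0| <= c) ->
  `|coupling S d k - coupling S d' k| <=
    (\sum_l `|Gamma S k l * emf S k 0 * emf S l 0| * 2) * c.
Proof.
move=> dc; rewrite /coupling -sumrB mulr_suml.
apply: le_trans (ler_norm_sum _ _ _) _; apply: ler_sum => l _.
rewrite -mulrBr normrM -[X in _ <= X]mulrA ler_wpM2l //.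
apply: le_trans (sin_lipschitz _ _) _.
have -> : d k 0 - d l 0 - (d' k 0 - d' l 0) = (d k 0 - d' k 0) - (d l 0 - d' l 0).
  by ring.
apply: le_trans (ler_normB _ _) _.
have := dc k; have := dc l; lra.
Qed.

Lemma acceleration_lipschitz : exists2 L, 0 < L & forall (d d' w w' : 'cV[R]_n) c,
  (forall j, `|d j 0 - d' j 0| <= c) -> (forall j, `|w j 0 - w' j 0| <= c) ->
  forall k, `|acceleration d w k - acceleration d' w' k| <= L * c.
Proof.
pose B k := (\sum_l `|Gamma S k l * emf S k 0 * emf S l 0| * 2 + damping S k 0)
  / inertia S k 0.
have B0 k : 0 <= B k.
  apply: divr_ge0; last exact/ltW/inertia_gt0.
  apply: addr_ge0; last exact: damping_ge0.
  by apply: sumr_ge0 => l _; rewrite mulr_ge0.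
(* The sum dominates every [B k]; the summand 1 makes the constant positive. *)
exists (1 + \sum_k B k); first by rewrite ltr_wpDr // sumr_ge0.
move=> d d' w w' c dc wc k.
have c0 : 0 <= c by apply: le_trans (dc k).
apply: le_trans (_ : B k * c <= _); last first.
  rewrite ler_wpM2r // (bigD1 k) //= addrCA lerDl addr_ge0 // sumr_ge0 // => l _.
have -> : acceleration d w k - acceleration d' w' k =
   - ((coupling S d k - coupling S d' k) + damping S k 0 * (w k 0 - w' k 0)) / inertia S k 0.
  by rewrite /acceleration; field; rewrite gt_eqF // inertia_gt0.
rewrite /B mulrAC normrM normfV [`|inertia S k 0|]gtr0_norm ?inertia_gt0 //.
apply: ler_wpM2r; first by rewrite invr_ge0 ltW // inertia_gt0.
rewrite normrN mulrDl.
apply: le_trans (ler_normD _ _) _; apply: lerD; first exact: coupling_lipschitz.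
by rewrite normrM ger0_norm ?damping_ge0 // ler_wpM2l ?damping_ge0.
Qed.

(** The swing equation becomes a first-order system on ['I_n + 'I_n], phases on the left and
    velocities on the right. Once [picard_global] has solved it, the voltages are read off the
    phases through [response]. *)
Lemma solution_exists (delta0 omega0 : 'cV[R]_n) :
  exists delta omega V theta Vb,
    [/\ is_solution S delta omega V theta Vb, delta 0 = delta0 & omega 0 = omega0].
Proof.
have [L L0 aL] := acceleration_lipschitz.
pose del (u : 'I_n + 'I_n -> R) : 'cV[R]_n := \col_k u (inl k).
pose ome (u : 'I_n + 'I_n -> R) : 'cV[R]_n := \col_k u (inr k).
pose F (u : 'I_n + 'I_n -> R) (p : 'I_n + 'I_n) : R :=
  match p with inl k => u (inr k) | inr k => acceleration (del u) (ome u) k end.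
pose x0 (p : 'I_n + 'I_n) : R :=
  match p with inl k => delta0 k 0 | inr k => omega0 k 0 end.
have F_lip u v (c : R) : (forall p, `|u p - v p| <= c) ->
    forall p, `|F u p - F v p| <= (L + 1) * c.
  move=> uv p; have c0 : 0 <= c by apply: le_trans (uv p).
  case: p => k /=.
    apply: le_trans (uv (inr k)) _; rewrite ler_peMl // lerDr ltW //.
  apply: le_trans (_ : L * c <= _); last by rewrite ler_wpM2r // lerDl.
  by apply: aL => j; rewrite !mxE.
have L10 : 0 < L + 1 by rewrite addr_gt0.
have [x x00 dx] := picard_global L10 F_lip x0.
(* Polar coordinates are chosen separately at each time, as [is_solution] constrains [V] and [theta]
   pointwise in t. *)
have /choice[q qP] t : exists q : 'I_n -> R * R, forall k, [/\ 0 <= (q k).1,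
    (q k).1 * cos (q k).2 =
      \sum_l response S k l * (emf S l 0 * cos (del (x t) l 0)) &
    (q k).1 * sin (q k).2 =
      \sum_l response S k l * (emf S l 0 * sin (del (x t) l 0))].
  suff /choice[q qP] : forall k, exists p : R * R, [/\ 0 <= p.1,
    p.1 * cos p.2 =
      \sum_l response S k l * (emf S l 0 * cos (del (x t) l 0)) &
    p.1 * sin p.2 =
      \sum_l response S k l * (emf S l 0 * sin (del (x t) l 0))] by exists q.
  by move=> k; exact: polar.
pose V t : 'cV[R]_n := \col_k (q t k).1.
pose theta t : 'cV[R]_n := \col_k (q t k).2.
exists (fun t => del (x t)), (fun t => ome (x t)), V, theta.
exists (fun t => - (invmx (complex_mx (L22 S)) *m (complex_mx (L12 S))^T
  *m phasor (V t) (theta t))).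
split; last 2 first.
- by apply/colP => k; rewrite mxE x00.
- by apply/colP => k; rewrite mxE x00.
move=> t t0.
have Vr : phasor (V t) (theta t) =
    complex_mx (response S) *m phasor (emf S) (del (x t)).
  by apply/phasor_responseP => k; rewrite !mxE; have [_ -> ->] := qP t k.
have dcol (f : 'I_n -> 'I_n + 'I_n) (d : 'cV[R]_n) :
    (forall k, d k 0 = F (x t) (f k)) ->
    is_derive_ge0 (fun t => \col_k x t (f k)) t d.
  move=> dE k; have colE : (fun s => (\col_k x s (f k) : 'cV[R]_n) k 0) = x^~ (f k).
    by apply/funext => s; rewrite mxE.
  rewrite -/(deriv_ge0 (fun s => (\col_k x s (f k) : 'cV[R]_n) k 0) t (d k 0)).
  by rewrite colE dE; exact: is_derive_deriv_ge0 (dx t t0 (f k)).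
split.
- by apply: dcol => k; rewrite mxE.
- exists (\col_k acceleration (del (x t)) (ome (x t)) k).
    by apply: dcol => k; rewrite mxE.
  apply/swing_entry => // k; rewrite [X in _ * X + _]mxE /acceleration mulrC.
  by rewrite divfK ?subrK // gt_eqF // inertia_gt0.
- by move=> k; rewrite mxE; have [] := qP t k.
- by apply/complex_response_solve.
Qed.

Section Solution.
Variables (delta omega V theta : R -> 'cV[R]_n) (Vb : R -> 'cV[R[i]]_nb).
Hypothesis sol : is_solution S delta omega V theta Vb.

Lemma solution_phasor t : 0 <= t ->
  phasor (V t) (theta t) = complex_mx (response S) *m phasor (emf S) (delta t).
Proof. by move=> /sol[_ _ _ /complex_response_solve[]]. Qed.

Lemma solution_deriv_delta t k : 0 <= t ->
  deriv_ge0 (fun s => delta s k 0) t (omega t k 0).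
Proof. by move=> /sol[+ _ _ _]; exact. Qed.

Lemma solution_deriv_omega t k : 0 <= t ->
  deriv_ge0 (fun s => omega s k 0) t (acceleration (delta t) (omega t) k).
Proof.
move=> t0; have [_ [alpha dalpha aE] _ _] := sol t0.
have /(_ k) := (swing_entry _ _ (solution_phasor t0)).1 aE.
move=> e; have -> : acceleration (delta t) (omega t) k = alpha k 0.
  rewrite /acceleration -e; field; rewrite gt_eqF // inertia_gt0 //.
exact: dalpha.
Qed.

End Solution.

(** Both rows have sum 1, so [g] may be shifted by [g j]; this kills the term at j, and only the
    term at i survives. *)
Lemma response_eq_rows (i j : 'I_n) (g : 'I_n -> R) :
  (forall k, k != i -> k != j -> response S i k = response S j k) ->
  \sum_l response S i l * g l - \sum_l response S j l * g l =
  (response S i i - response S j i) * (g i - g j).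
Proof.
move=> ij.
transitivity (\sum_l (response S i l - response S j l) * (g l - g j)).
  under [RHS]eq_bigr do rewrite mulrBr !mulrBl.
  rewrite !sumrB -!mulr_suml.
  by rewrite !response_row_sum // subrr subr0.
rewrite (bigD1 i) //= big1 ?addr0 // => k ki.
have [->|kj] := eqVneq k j; first by rewrite subrr mulr0.
by rewrite ij // subrr mul0r.
Qed.

(** * Synchronization of a pair of generators *)

Section Pair.
Variables i j : 'I_n.
Hypotheses (ij : i != j) (Mij : inertia S i 0 = inertia S j 0).

(* The last clause is vacuous for n = 2; for n >= 3 it amounts to
   [Sset i j (Gamma S)], see [Sset_Gamma]. *)
Definition twins : Prop :=
  [/\ damping S i 0 = damping S j 0, injection S i 0 = injection S j 0,
      emf S i 0 = emf S j 0 &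
      forall k, k != i -> k != j ->
        Gamma S i k = Gamma S j k /\ response S i k = response S j k].

(** Compared term by term: the term at i occurs only in the sum for j and conversely, while the
    other terms have equal coefficients and sines whose arguments differ by d_i - d_j. *)
Lemma twins_coupling (d : 'cV[R]_n) : twins ->
  `|coupling S d i - coupling S d j| <=
    (\sum_l (`|Gamma S i l * emf S i 0 * emf S l 0| +
             `|Gamma S j l * emf S j 0 * emf S l 0|)) * `|d i 0 - d j 0|.
Proof.
move=> [_ _ Eij kij].
have sin_le (a : R) : `|sin a| <= `|a|.
  by have := sin_lipschitz a 0; rewrite sin0 !subr0.
rewrite /coupling -sumrB mulr_suml.
apply: le_trans (ler_norm_sum _ _ _) _; apply: ler_sum => l _.
rewrite mulrDl.
have [->|li] := eqVneq l i.
  rewrite subrr sin0 mulr0 sub0r normrN normrM.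
  apply: le_trans (_ : _ <= `|Gamma S j i * emf S j 0 * emf S i 0| * `|d i 0 - d j 0|) _.
    by rewrite ler_wpM2l // distrC.
  by rewrite lerDr mulr_ge0.
have [->|lj] := eqVneq l j.
  rewrite subrr sin0 mulr0 subr0 normrM.
  apply: le_trans (_ : _ <= `|Gamma S i j * emf S i 0 * emf S j 0| * `|d i 0 - d j 0|) _.
    by rewrite ler_wpM2l.
  by rewrite lerDl mulr_ge0.
have [<- _] := kij l li lj; rewrite -Eij -mulrBr normrM.
apply: le_trans (_ : _ <= `|Gamma S i l * emf S i 0 * emf S l 0| * `|d i 0 - d j 0|) _.
  rewrite ler_wpM2l // (le_trans (sin_lipschitz _ _)) //.
  by rewrite opprB addrA subrK.
by rewrite lerDl mulr_ge0.
Qed.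

Lemma twins_synchronized : twins -> synchronized S i j.
Proof.
move=> tw d0 w0; rewrite /Xset /= => d0ij w0ij delta omega V theta Vb sol dE wE.
have [Dij fij Eij kij] := tw.
pose C := \sum_l (`|Gamma S i l * emf S i 0 * emf S l 0| +
             `|Gamma S j l * emf S j 0 * emf S l 0|).
have C0 : 0 <= C by apply: sumr_ge0 => l _; rewrite addr_ge0.
pose K := (C + damping S i 0) / inertia S i 0.
have M0 := inertia_gt0 S i.
have K0 : 0 <= K by rewrite divr_ge0 ?addr_ge0 ?damping_ge0 // ltW.
have dij t : 0 <= t -> delta t i 0 = delta t j 0.
  move=> t0; apply/eqP; rewrite -subr_eq0; apply/eqP; move: t t0.
  apply: (@second_order_gronwall R (fun t => delta t i 0 - delta t j 0)
    (fun t => omega t i 0 - omega t j 0)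
    (fun t => acceleration (delta t) (omega t) i - acceleration (delta t) (omega t) j) K).
  - exact: K0.
  - by move=> t t0; apply: deriv_ge0B; exact: (solution_deriv_delta sol t0).
  - by move=> t t0; apply: deriv_ge0B; exact: (solution_deriv_omega sol t0).
  - move=> t t0.
    have -> : acceleration (delta t) (omega t) i - acceleration (delta t) (omega t) j =
      - ((coupling S (delta t) i - coupling S (delta t) j) +
         damping S i 0 * (omega t i 0 - omega t j 0)) / inertia S i 0.
      by rewrite /acceleration -fij -Dij -Mij; field; rewrite gt_eqF.
    rewrite normrM normfV normrN [`|inertia S i 0|]gtr0_norm // /K mulrAC.
    apply: ler_wpM2r; first by rewrite invr_ge0 ltW.
    apply: le_trans (ler_normD _ _) _.
    rewrite normrM [`|damping S i 0|]ger0_norm ?damping_ge0 //.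
    have := twins_coupling (delta t) tw; rewrite -/C.
    have : 0 <= C * `|omega t i 0 - omega t j 0| by rewrite mulr_ge0.
    have : 0 <= damping S i 0 * `|delta t i 0 - delta t j 0|.
      by rewrite mulr_ge0 ?damping_ge0.
    lra.
  - by rewrite dE d0ij subrr.
  - by rewrite wE w0ij subrr.
move=> t t0; split; first exact: dij.
have kij' k (ki : k != i) (kj : k != j) := (kij k ki kj).2.
have := (phasor_responseP _ _ _ _ _).1 (solution_phasor sol t0) => h.
rewrite /= !mxE; have [-> ->] := h i; have [-> ->] := h j.
(* By [response_eq_rows] the voltages of i and j differ by a multiple of the difference of their
   internal voltages, which is 0. *)
congr (_ +i* _); apply/eqP; rewrite -subr_eq0 response_eq_rows //.
  by rewrite Eij dij // subrr mulr0.
by rewrite Eij dij // subrr mulr0.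
Qed.

(** Along the solution from (d, w), equal phases have equal derivatives, and so do the resulting
    equal velocities. At t = 0 the accelerations agree, and the common inertia cancels; the other
    two identities are the real and imaginary parts of the voltages. *)
Lemma synchronized_balance (d w : 'cV[R]_n) : synchronized S i j ->
  d i 0 = d j 0 -> w i 0 = w j 0 ->
  [/\ injection S i 0 - coupling S d i - damping S i 0 * w i 0 =
      injection S j 0 - coupling S d j - damping S j 0 * w j 0,
      \sum_l response S i l * (emf S l 0 * cos (d l 0)) =
      \sum_l response S j l * (emf S l 0 * cos (d l 0)) &
      \sum_l response S i l * (emf S l 0 * sin (d l 0)) =
      \sum_l response S j l * (emf S l 0 * sin (d l 0))].
Proof.
move=> sync dij wij.
have [delta [omega [V [theta [Vb [sol dE wE]]]]]] := solution_exists d w.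
have {}sync t t0 := sync d w dij wij _ _ _ _ _ sol dE wE t t0.
have deltaij t : 0 <= t -> delta t i 0 = delta t j 0 by move=> /sync[].
have omegaij t : 0 <= t -> omega t i 0 = omega t j 0.
  move=> t0; apply: (deriv_ge0_unique t0 deltaij);
    exact: (solution_deriv_delta sol).
have acc k : deriv_ge0 (fun s => omega s k 0) 0 (acceleration (delta 0) (omega 0) k).
  exact: (solution_deriv_omega sol (lexx 0)).
have := deriv_ge0_unique (lexx 0) omegaij (acc i) (acc j).
rewrite /acceleration dE wE -Mij => /(mulIf _) ->; last first.
  by rewrite invr_neq0 // gt_eqF // inertia_gt0.
have [_] := sync 0 (lexx 0); rewrite /Xset /= !mxE.
have := (phasor_responseP _ _ _ _ _).1 (solution_phasor sol (lexx 0)) => h.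
by have [-> ->] := h i; have [-> ->] := h j; rewrite dE => -[].
Qed.

Lemma synchronized_twins : synchronized S i j -> twins.
Proof.
move=> sync.
have coup0 k : coupling S 0 k = 0.
  by apply: big1 => l _; rewrite !mxE subrr sin0 mulr0.
have zero k : (0 : 'cV[R]_n) k 0 = 0 by rewrite mxE.
have zero_ij : (0 : 'cV[R]_n) i 0 = (0 : 'cV[R]_n) j 0 by rewrite !zero.
have one k : (const_mx 1 : 'cV[R]_n) k 0 = 1 by rewrite mxE.
have one_ij : (const_mx 1 : 'cV[R]_n) i 0 = (const_mx 1 : 'cV[R]_n) j 0.
  by rewrite !one.
(* At rest with equal phases only the injections remain; the cosine identity is kept for the
   voltages. *)
have [] := synchronized_balance sync zero_ij zero_ij.
rewrite !coup0 !zero !mulr0 !subr0 => fij cos0E _.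
(* Unit velocities bring in the damping. *)
have [] := synchronized_balance sync zero_ij one_ij.
rewrite !coup0 !one !mulr1 !subr0 fij => /addrI/oppr_inj Dij _ _.
have bal k : k != i -> k != j -> Gamma S i k * emf S i 0 = Gamma S j k * emf S j 0 /\
    response S i k = response S j k.
  (* With phase pi / 2 at k alone, the only nonzero sine is that of k, which isolates column k in
     both the coupling and the imaginary part of the voltage. *)
  move=> ki kj; pose d : 'cV[R]_n := \col_l (if l == k then pi / 2 else 0).
  have dk l : l != k -> d l 0 = 0 by move=> lk; rewrite mxE (negPf lk).
  have dkk : d k 0 = pi / 2 by rewrite mxE eqxx.
  have di : d i 0 = 0 by rewrite dk // eq_sym.
  have dj : d j 0 = 0 by rewrite dk // eq_sym.
  have coup l : d l 0 = 0 -> coupling S d l = - (Gamma S l k * emf S l 0 * emf S k 0).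
    move=> dl; rewrite /coupling (bigD1 k) //= big1; last first.
      by move=> m mk; rewrite dl dk // subrr sin0 mulr0.
    by rewrite dl dkk sub0r sinN sin_pihalf mulrN1 addr0.
  have resp l : \sum_m response S l m * (emf S m 0 * sin (d m 0)) =
      response S l k * emf S k 0.
    rewrite (bigD1 k) //= big1; last by move=> m mk; rewrite dk // sin0 !mulr0.
    by rewrite dkk sin_pihalf mulr1 addr0.
  have [] := synchronized_balance sync (etrans di (esym dj)) zero_ij.
  have Ek0 : emf S k 0 != 0 by rewrite gt_eqF // emf_gt0.
  rewrite !coup // !zero !mulr0 !subr0 fij !opprK !resp.
  by move=> /addrI/(mulIf Ek0) e _ /(mulIf Ek0).
have Eij : emf S i 0 = emf S j 0.
  have : (response S i i - response S j i) * (emf S i 0 - emf S j 0) = 0.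
    rewrite -(@response_eq_rows i j (fun l => emf S l 0)); last first.
      by move=> k ki kj; have [] := bal k ki kj.
    apply/eqP; rewrite subr_eq0; apply/eqP; move: cos0E.
    under eq_bigr do rewrite zero cos0 mulr1.
    by under [X in _ = X -> _]eq_bigr do rewrite zero cos0 mulr1.
  (* The first factor is nonzero because the diagonal entry of column i is strictly the largest. *)
  move/eqP; rewrite mulf_eq0 !subr_eq0 => /orP[/eqP e|/eqP//].
  by have := @response_lt_diag _ _ _ S n_gt0 j i; rewrite eq_sym ij e ltxx => /(_ isT).
split=> // k ki kj; have [e1 e2] := bal k ki kj; split=> //.
by move: e1; rewrite Eij => /mulIf -> //; rewrite gt_eqF // emf_gt0.
Qed.

Lemma synchronizedP : synchronized S i j <-> twins.
Proof. by split; [exact: synchronized_twins|exact: twins_synchronized]. Qed.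

End Pair.

End Solutions.

(** * The symmetry conditions in coordinates *)

Lemma SsetP (R : realType) (n : nat) (i j : 'I_n) (A : 'M[R]_n) :
  Sset i j A <-> forall a b, A a (tperm i j b) = A (tperm i j a) b.
Proof.
rewrite /Sset /= -xcolE -xrowE; split=> [/matrixP h a b|h].
  by have := h a b; rewrite !mxE.
by apply/matrixP => a b; rewrite !mxE.
Qed.

Lemma Sset_diag (R : realType) (n : nat) (i j : 'I_n) (v : 'cV[R]_n) :
  Sset i j (cdiag_mx v) <-> v i 0 = v j 0.
Proof.
rewrite SsetP /cdiag_mx; split=> [/(_ i j)|vij a b].
  by rewrite tpermR tpermL !mxE !eqxx.
rewrite !mxE -[b in RHS](tpermK i j) (inj_eq perm_inj).
by congr (_ *+ _); case: tpermP => [->|->|].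
Qed.

(** The rows of [Gamma] sum to the inverse reactances. Commutation gives Gamma_ii = Gamma_jj, hence
    equal row sums and reactances, so the rows of [response] agree wherever those of [Gamma] do.
    Conversely, the two equalities at a third generator k, which exists as n >= 3, force equal
    reactances, hence Gamma_ii = Gamma_jj. *)
Lemma Sset_Gamma (R : realType) (n nb : nat) (S : power_system R n nb) (i j : 'I_n) :
  (2 < n)%N -> i != j ->
  Sset i j (Gamma S) <-> forall k, k != i -> k != j ->
    Gamma S i k = Gamma S j k /\ response S i k = response S j k.
Proof.
move=> n3 ij; have n_gt0 : (0 < n)%N by apply: leq_trans n3.
have chi k : (gen_reactance S k 0)^-1 != 0.
  by rewrite invr_neq0 // gt_eqF // gen_reactance_gt0.
have rsum k : \sum_l Gamma S k l = (gen_reactance S k 0)^-1.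
  under eq_bigr do rewrite Gamma_entry.
  by rewrite -mulr_sumr response_row_sum // mulr1.
have Gs a b : Gamma S a b = Gamma S b a 
  by rewrite -[Gamma S in LHS]Gamma_tr [(_^T) _ _]mxE.
(* In the difference of the two row sums the other columns cancel, and so do the symmetric entries
   Gamma_ij and Gamma_ji. *)
have rowdiff : (forall k, k != i -> k != j -> Gamma S i k = Gamma S j k) ->
    (gen_reactance S i 0)^-1 - (gen_reactance S j 0)^-1 = Gamma S i i - Gamma S j j.
  move=> G; rewrite -!rsum -sumrB (bigD1 i) //= (bigD1 j) 1?eq_sym //= big1.
    by rewrite (Gs j i); ring.
  by move=> k /andP[ki kj]; rewrite G // subrr.
split=> [/SsetP G k ki kj|G].
  have Gk l : l != i -> l != j -> Gamma S i l = Gamma S j l.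
    by move=> li lj; have := G i l; rewrite tpermL tpermD // eq_sym.
  split; first exact: Gk.
  have := G i j; rewrite tpermL tpermR => Gii.
  have := rowdiff Gk; rewrite Gii subrr => /eqP; rewrite subr_eq0 => /eqP chiE.
  by have := Gk k ki kj; rewrite !Gamma_entry chiE => /(mulfI (chi j)).
have Gk l : l != i -> l != j -> Gamma S i l = Gamma S j l.
  by move=> li lj; have [] := G l li lj.
have [k /andP[ki kj]] : exists k, (k != i) && (k != j).
  have := cardC (pred2 i j); rewrite card2 ij card_ord => e.
  have /card_gt0P[k] : (0 < #|predC (pred2 i j)|)%N by rewrite -(ltn_add2l 2) e.
  by rewrite !inE negb_or => h; exists k.
have [e1 e2] := G k ki kj.
have chiE : (gen_reactance S i 0)^-1 = (gen_reactance S j 0)^-1.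
  move: e1; rewrite !Gamma_entry e2 => /mulIf; apply.
  by rewrite gt_eqF // response_gt0.
have Gii : Gamma S i i = Gamma S j j.
  by apply/eqP; rewrite -subr_eq0 -rowdiff // chiE subrr.
apply/SsetP => a b.
case: tpermP => [->|->|/eqP bi /eqP bj]; case: tpermP => [->|->|/eqP ai /eqP aj] //.
- by rewrite !(Gs a) Gk.
- by rewrite !(Gs a) Gk.
- by rewrite Gk.
- by rewrite Gk.
Qed.

Theorem theorem2 (R : realType) :
  (forall (nb : nat) (S : power_system R 2 nb),
     inertia S 0 0 = inertia S 1 0 ->
     (synchronized S 0 1 <->
      [/\ damping S 0 0 = damping S 1 0,
          injection S 0 0 = injection S 1 0 &
          emf S 0 0 = emf S 1 0])) /\
  (forall (n nb : nat) (S : power_system R n nb) (i j : 'I_n),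
     (3 <= n)%N -> i != j ->
     Sset i j (inertia_mx S) ->
     (synchronized S i j <->
      [/\ Sset i j (damping_mx S),
          Xset i j (injection S),
          Xset i j (emf S) &
          Sset i j (Gamma S)])).
Proof.
split.
  move=> nb S Mij; rewrite synchronizedP //; split=> [[]|[? ? ?]] //.
  (* With two generators there is no third index, so the last clause of [twins] is settled by cases
     on [k]. *)
  by split=> // -[[|[|]]].
move=> n nb S i j n3 ij /Sset_diag Mij.
have n_gt0 : (0 < n)%N by apply: leq_trans n3.
rewrite synchronizedP //; split=> -[d f e g]; split=> //.
- exact/Sset_diag.
- exact/Sset_Gamma.
- exact/Sset_diag.
- exact/Sset_Gamma.
Qed.
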